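(* Let $\alpha>0$ with $\alpha\notin\{1,2,3,\dots\}$, let $n=[\alpha]+1$, let $m\in(0,1]$, let $q>1$ and $p=\frac{q}{q-1}$. Let $a<b$ be real numbers, and let $I\subset\mathbb{R}$ be an interval with $[a,b]\subset I$ and $y/m\in I$ for every $y\in[a,b]$. Let $f:I\to\mathbb{R}$ be $(n+1)$ times differentiable on $I$ with $f^{(n+1)}\in L[a,b]$. If $|f^{(n+1)}|^{q}$ is $m$-convex on $[a,b]$, then $$\left|\frac{f^{(n)}(a)+f^{(n)}(b)}{2}-\frac{\Gamma(n-\alpha+1)}{2(b-a)^{n-\alpha}}\left[({}^{C}D_{a^{+}}^{\alpha}f)(b)+(-1)^{n}({}^{C}D_{b^{-}}^{\alpha}f)(a)\right]\right|$$ $$\le \frac{b-a}{2^{1+\frac1q}}\left(\frac{1}{(p(n-\alpha)+1)^{\frac1p}}\right)\left(\left|f^{(n+1)}(a)\right|^{q}+m\left|f^{(n+1)}\left(\tfrac{b}{m}\right)\right|^{q}\right)^{\frac1q}.$$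
   Context: $[\alpha]$ is the integer part of $\alpha$, $\Gamma$ is the Gamma function, and $L[a,b]$ is the space of Lebesgue integrable functions on $[a,b]$. At endpoints of $I$ belonging to $I$, derivatives are one-sided. Caputo fractional derivatives of order $\alpha$ (with $n=[\alpha]+1$): $$({}^{C}D_{a^{+}}^{\alpha}f)(x)=\frac{1}{\Gamma(n-\alpha)}\int_a^x\frac{f^{(n)}(t)}{(x-t)^{\alpha-n+1}}\,dt\quad(x>a),$$ $$({}^{C}D_{b^{-}}^{\alpha}f)(x)=\frac{(-1)^n}{\Gamma(n-\alpha)}\int_x^b\frac{f^{(n)}(t)}{(t-x)^{\alpha-n+1}}\,dt\quad(x<b).$$ $m$-convexity: for $m\in(0,1]$, a function $g:I\to\mathbb{R}$ is called $m$-convex on $[c,d]\subset I$ (where $y/m\in I$ for all $y\in[c,d]$) if for all $x,y\in[c,d]$ and $t\in[0,1]$, $$g(tx+(1-t)y)=g\left(tx+m(1-t)\tfrac{y}{m}\right)\le t\,g(x)+m(1-t)\,g\left(\tfrac{y}{m}\right).$$ *)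

(* Defs.v *)
From HB Require Import structures.
From mathcomp Require Import all_boot all_order all_algebra.
From mathcomp Require Import all_classical all_reals all_analysis.

Set Implicit Arguments.
Unset Strict Implicit.
Unset Printing Implicit Defensive.

Import Order.TTheory GRing.Theory Num.Theory.
Import numFieldNormedType.Exports.

Local Open Scope classical_set_scope.
Local Open Scope ring_scope.

(* A function I -> R is represented by a total function R -> R; the difference
   quotient is only taken at points of I, so the values outside I are never
   used. At an endpoint of I the limit is the one-sided derivative. *)
Definition diff_quotient_on {R : realType} (I : set R) (g : R -> R) (x : R) :=
  (fun y => (g y - g x) / (y - x)) @ within I x^'.

Definition derivable_on {R : realType} (I : set R) (g : R -> R) : Prop :=
  forall x, I x -> cvg (diff_quotient_on I g x).

Definition derive_on {R : realType} (I : set R) (g : R -> R) : R -> R :=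
  fun x => lim (diff_quotient_on I g x).

Definition derive_n_on {R : realType} (I : set R) (k : nat) (g : R -> R) :
    R -> R :=
  iter k (derive_on I) g.

Definition n_times_derivable_on {R : realType} (I : set R) (k : nat)
    (g : R -> R) : Prop :=
  forall j, (j < k)%N -> derivable_on I (derive_n_on I j g).

(* Euler's integral; meaningful for x > 0. *)
Definition Gamma {R : realType} (x : R) : R :=
  \int[@lebesgue_measure R]_(t in `]0, +oo[) (t `^ (x - 1) * expR (- t)).

Definition caputo_order {R : realType} (alpha : R) : nat :=
  (Num.truncn alpha).+1.

(* Left-sided Caputo derivative with base point a, evaluated at x > a. *)
Definition caputo_left {R : realType} (I : set R) (alpha a : R) (f : R -> R)
    (x : R) : R :=
  let n := caputo_order alpha in
  1 / Gamma (n%:R - alpha) *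
  \int[@lebesgue_measure R]_(t in `[a, x])
    (derive_n_on I n f t / (x - t) `^ (alpha - n%:R + 1)).

(* Right-sided Caputo derivative with base point b, evaluated at x < b. *)
Definition caputo_right {R : realType} (I : set R) (alpha b : R) (f : R -> R)
    (x : R) : R :=
  let n := caputo_order alpha in
  (-1) ^+ n / Gamma (n%:R - alpha) *
  \int[@lebesgue_measure R]_(t in `[x, b])
    (derive_n_on I n f t / (t - x) `^ (alpha - n%:R + 1)).

(* For m != 0 the argument t * x + (1 - t) * y is
   t * x + m * (1 - t) * (y / m). The points y / m need not lie in [c, d]:
   they are only required to lie in the domain of g. *)
Definition m_convex_on {R : realType} (m c d : R) (g : R -> R) : Prop :=
  forall x y t, c <= x <= d -> c <= y <= d -> 0 <= t <= 1 ->
    g (t * x + (1 - t) * y) <= t * g x + m * (1 - t) * g (y / m).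

(* Main.v *)
Require Import Defs.
From mathcomp Require Import all_boot all_order all_algebra.
From mathcomp Require Import all_classical all_reals all_analysis.
From mathcomp Require Import measurable_realfun lra ring.

Import Order.TTheory GRing.Theory Num.Theory.
Import numFieldNormedType.Exports.

Local Open Scope classical_set_scope.
Local Open Scope ring_scope.

(* Write g = f^(n), h = f^(n+1), s = n - alpha and L = b - a.  As
   Gamma(s + 1) = s Gamma(s), the left-hand side is (2 L^s)^-1 times
     s \int_a^c w (g(a) - g) + s \int_c^b w (g(b) - g),
   where w(t) = (t - a)^(s-1) + (b - t)^(s-1) and c is the midpoint.
   Applying m-convexity at the endpoints bounds |h| by the continuous function
   phi(t) = (((b - t) |h(a)|^q + (t - a) m |h(b/m)|^q) / L)^(1/q); hence |g(x) - g(y)|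
   is at most |G(x) - G(y)| for a C^1 primitive G of phi.
   With W(t) = (t - a)^s - (b - t)^s, integration by parts reduces the
   problem to bounding \int |W| phi.  Since |W(t)| <= |a + b - 2t|^s, Young's
   inequality with the weights that are optimal after integration (i.e.
   Hoelder's inequality) gives the constant.  All this is done pointwise,
   comparing the integrand with the derivative of an explicit function. *)

Local Notation mu := lebesgue_measure.

(** * Powers, and a fundamental theorem of calculus for derivatives singular at the endpoints *)

(* The library's x `^ r is 1 for x < 0 and r arbitrary; the absolute value makes
   the function continuous on the whole line when r > 0. *)
Definition abspow {R : realType} (r x : R) : R := `|x| `^ r.

Lemma abspow_ge0 {R : realType} (r x : R) : 0 <= abspow r x.
Proof. exact: powR_ge0. Qed.

Lemma abspow0 {R : realType} (r : R) : 0 < r -> abspow r 0 = 0.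
Proof. by move=> r0; rewrite /abspow normr0 powR0// gt_eqF. Qed.

Lemma gt0_is_derive_abspow {R : realType} (r x : R) : 0 < x ->
  is_derive x 1 (abspow r) (r * abspow (r - 1) x).
Proof.
move=> x0; rewrite /abspow (gtr0_norm x0).
apply: (@near_eq_is_derive _ _ _ (fun t => t `^ r)); last exact: is_derive1_powR.
near=> t; rewrite gtr0_norm//; near: t; exact: lt_nbhsr.
Unshelve. all: by end_near. Qed.

Lemma gt0_continuous_abspow {R : realType} (r x : R) : 0 < x ->
  {for x, continuous (abspow r)}.
Proof.
move=> x0; apply/differentiable_continuous/derivable1_diffP.
by case: (gt0_is_derive_abspow r x x0).
Qed.

Lemma continuous_abspow {R : realType} (r : R) : 0 < r -> continuous (abspow r).
Proof.
move=> r0 x; have [x0|x0|->] := ltgtP x 0.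
- have -> : abspow r = abspow r \o -%R.
    by apply/funext => t; rewrite /abspow/= normrN.
  apply: continuous_comp; first exact: opp_continuous.
  by apply: gt0_continuous_abspow; rewrite oppr_gt0.
- exact: gt0_continuous_abspow.
- rewrite /continuous_at abspow0//; apply/cvgrPdist_lt => e e0.
  (* The radius at 0 is [e^(1/r)], since [|t| < e^(1/r)] yields [|t|^r < e]. *)
  have e0' : 0 < e `^ r^-1 by rewrite powR_gt0.
  exists (e `^ r^-1) => //= t /=; rewrite sub0r normrN => te.
  rewrite sub0r normrN /abspow ger0_norm ?powR_ge0//.
  rewrite -[ltRHS]powRr1 ?ltW// -(mulVf (lt0r_neq0 r0)) powRrM.
  by rewrite gt0_ltr_powR ?nnegrE ?powR_ge0.
Qed.

(** The integrand may blow up at both endpoints. The theorem for closed intervals is applied on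
    [D k], which exhausts []a, b[]; monotone convergence, available as [f >= 0], and the one-sided
    limits of [F] then give the value. *)
Lemma ge0_oo_continuous_FTC2 {R : realType} (f F : R -> R) (a b : R) :
  a < b ->
  (forall x, a < x < b -> 0 <= f x) ->
  (forall x, a < x < b -> {for x, continuous f}) ->
  (forall x, a < x < b -> is_derive x 1 F (f x)) ->
  F x @[x --> a^'+] --> F a -> F x @[x --> b^'-] --> F b ->
  (\int[lebesgue_measure]_(x in `]a, b[) (f x)%:E = (F b - F a)%:E)%E.
Proof.
move=> ab f0 fc dF Fa Fb.
(* The shift by two gives [e 0 = (b - a) / 4], so that every [D k] is a nondegenerate interval. *)
pose e (k : nat) := (b - a) / 2 * (k.+2%:R)^-1.
have e0 k : 0 < e k by rewrite /e mulr_gt0// ?invr_gt0 ?ltr0n// divr_gt0// subr_gt0.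
have eab k : a + e k < b - e k.
  have : e k < (b - a) / 2.
    rewrite /e gtr_pMr ?divr_gt0 ?subr_gt0//.
    by rewrite invf_lt1 ?ltr0n// ltr1n.
  lra.
have ecvg : e k @[k --> \oo] --> 0.
  rewrite -[X in _ --> X](mulr0 ((b - a) / 2)); apply: cvgM; first exact: cvg_cst.
  have := @cvg_harmonic R; rewrite -cvg_shiftS; exact.
pose D k : set R := `[a + e k, b - e k]%classic.
have Dab k x : D k x -> a < x < b.
  rewrite /D /= in_itv/= => /andP[h1 h2]; have := e0 k.
  by move=> ek; apply/andP; split; lra.
have UD : `]a, b[%classic = \bigcup_k D k.
  apply/seteqP; split => [x|x [k _ /Dab]]; last by rewrite /= in_itv.
  rewrite /= in_itv/= => /andP[ax xb].
  have /cvgrPdist_lt : e k @[k --> \oo] --> 0 by [].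
  have d0 : 0 < Num.min (x - a) (b - x) by rewrite lt_min !subr_gt0 ax.
  move=> /(_ _ d0)[k _ /(_ k (leqnn k))] /=.
  rewrite sub0r normrN gtr0_norm// lt_min => /andP[h1 h2].
  by exists k => //; rewrite /D/= in_itv/=; apply/andP; split; lra.
have FTC k : (\int[lebesgue_measure]_(x in D k) (f x)%:E
    = (F (b - e k) - F (a + e k))%:E)%E.
  rewrite EFinB; apply: continuous_FTC2 => //.
  - apply: continuous_in_subspaceT => x; rewrite inE => /Dab xab.
    exact: fc.
  - have FC x : D k x -> {for x, continuous F}.
      move=> /Dab/dF[df _]; exact/differentiable_continuous/derivable1_diffP.
    split.
    + move=> x /subset_itv_oo_cc /(Dab k) /dF[]//.
    + by apply: cvg_at_right_filter; apply: FC; rewrite /D/= in_itv/= lexx ltW.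
    + by apply: cvg_at_left_filter; apply: FC; rewrite /D/= in_itv/= lexx ltW.
  - move=> x /subset_itv_oo_cc /(Dab k) /dF[_ <-]//.
    by rewrite derive1E.
have := @ge0_nondecreasing_set_cvg_integral _ (measurableTypeR R) R D (EFin \o f)
  lebesgue_measure.
rewrite -UD => /(_ _ _ _ _)H.
have {H} : (\int[lebesgue_measure]_(x in D i) (f x)%:E)%E @[i --> \oo] -->
    (\int[lebesgue_measure]_(x in `]a, b[) (f x)%:E)%E.
  apply: H.
  - move=> i j ij; apply/subsetPset => x; rewrite /D/= !in_itv/= => /andP[h1 h2].
    have : e j <= e i.
      rewrite /e ler_pM2l ?divr_gt0 ?subr_gt0//.
      by rewrite lef_pV2 ?posrE ?ltr0n// ler_nat !ltnS.
    by move=> ?; apply/andP; split; lra.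
  - by move=> i; exact: measurable_itv.
  - move=> i; apply/measurable_EFinP; apply: (@measurable_funS _ _ _ _ `]a, b[%classic) => //.
      by move=> x /Dab; rewrite /= in_itv.
    apply: open_continuous_measurable_fun => // x; rewrite inE/= in_itv/=.
    exact: fc.
  - by move=> i x /Dab /f0; rewrite lee_fin.
under eq_cvg do rewrite FTC.
move=> H; apply: cvg_unique H _ => //.
apply: cvg_EFin; first exact: nearW.
apply: cvgB.
- move/cvg_at_leftP : Fb; apply; split => [k|]; first by rewrite gtrBl.
  by rewrite -[X in _ --> X]subr0; apply: cvgB => //; exact: cvg_cst.
- move/cvg_at_rightP : Fa; apply; split => [k|]; first by rewrite ltrDl.
  by rewrite -[X in _ --> X]addr0; apply: cvgD => //; exact: cvg_cst.
Qed.

(** * The recursion of the Gamma function *)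

(** For [t >= 1] and [s <= 1] one has [t^s <= t], while [e^t = (e^(t/2))^2 >= (1 + t/2)^2 > t^2/4];
    hence the product is below [4 / t]. *)
Lemma abspow_expRN_cvgy {R : realType} (s : R) : s <= 1 ->
  abspow s t * expR (- t) @[t --> +oo] --> 0.
Proof.
move=> s1; apply/cvgrPdist_lt => e e0; near=> t.
have t1 : 1 <= t by near: t; exact: nbhs_pinfty_ge.
have te : 4 / e < t by near: t; apply: nbhs_pinfty_gt; rewrite num_real.
have t0 : 0 < t by rewrite (lt_le_trans _ t1).
rewrite sub0r normrN /abspow (gtr0_norm t0) ger0_norm; last first.
  by rewrite mulr_ge0 ?powR_ge0 ?expR_ge0.
apply: (@le_lt_trans _ _ (t * expR (- t))).
  by rewrite ler_wpM2r ?expR_ge0// ler1_powR.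
rewrite expRN ltr_pdivrMr ?expR_gt0//.
have -> : expR t = expR (t / 2) ^+ 2.
  by rewrite -expRM_natl -mulr_natl mulrCA divff ?mulr1.
have := expR_ge1Dx (t / 2); set E := expR _ => hE.
have e4 : 4 < t * e by rewrite -ltr_pdivrMr.
have : t ^+ 2 / 4 < E ^+ 2 by nra.
move=> h; apply: (@le_lt_trans _ _ (e * (t ^+ 2 / 4))); first by nra.
by rewrite ltr_pM2l.
Unshelve. all: by end_near. Qed.

Lemma is_derive_abspow_expRN {R : realType} (s t : R) : 0 < t ->
  is_derive t 1 (fun t => abspow s t * expR (- t))
    (s * abspow (s - 1) t * expR (- t) - abspow s t * expR (- t)).
Proof.
move=> t0; have d1 := gt0_is_derive_abspow s t t0.
have d2 : is_derive t 1 (fun t : R => expR (- t)) (- expR (- t)).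
  have := @is_derive1_comp R expR -%R t (expR (- t)) (-1) _ _.
  rewrite mulrN1; apply; exact: is_deriveNid.
apply: (@is_derive_eq _ _ _ (abspow s * (fun t => expR (- t)))).
rewrite /GRing.scale/=; ring.
Qed.

(** Integration by parts with [F t = t^s e^(-t)], whose derivative is [v - u]: over []0, +oo[] the
    function [u] integrates to [Gamma (s + 1)] and [v] to [s * Gamma s]. Both totals turn out to be
    [F s] plus the integral of [u] below [s] plus that of [v] above [s]. *)
Lemma Gamma_recursion {R : realType} (s : R) : 0 < s <= 1 ->
  0 < Gamma s /\ Gamma (s + 1) = s * Gamma s.
Proof.
move=> /andP[s0 s1].
pose E (t : R) := expR (- t).
pose F t := abspow s t * E t.
pose u t := F t.
pose v t := s * abspow (s - 1) t * E t.
have cE : continuous E.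
  move=> t; apply: continuous_comp; first exact: opp_continuous.
  exact: continuous_expR.
have cu : continuous u.
  by move=> t; apply: continuousM; [exact: continuous_abspow|exact: cE].
have cv (t : R) : 0 < t -> {for t, continuous v}.
  move=> t0; apply: continuousM; last exact: cE.
  by apply: continuousM; [exact: cst_continuous|exact: gt0_continuous_abspow].
have dF (t : R) : 0 < t -> is_derive t 1 F (v t - u t).
  exact: is_derive_abspow_expRN.
have F0 : F 0 = 0 by rewrite /F abspow0// mul0r.
have Fs0 : 0 < F s by rewrite mulr_gt0 ?expR_gt0// /abspow powR_gt0// normr_gt0 gt_eqF.
have u0 t : 0 <= u t by rewrite mulr_ge0 ?expR_ge0 ?abspow_ge0 ?powR_ge0.
have v0 t : 0 <= v t by rewrite !mulr_ge0 ?expR_ge0 ?abspow_ge0 ?powR_ge0// ltW.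
(* The sign of [v - u] changes only at [t = s]. Cutting there gives a nonnegative integrand on each
   side, as required by both versions of the fundamental theorem used below. *)
have vuE (t : R) : 0 < t -> v t - u t = abspow (s - 1) t * E t * (s - t).
  move=> t0; rewrite /v /u /F /abspow gtr0_norm//.
  by rewrite -(mulr_powRB1 (ltW t0) s0); ring.
have mu_ (D : set R) : measurable D -> measurable_fun D (EFin \o u).
  move=> mD; apply/measurable_EFinP/measurable_funTS.
  exact: continuous_measurable_fun.
have mv (D : set R) : measurable D -> D `<=` `]0, +oo[%classic ->
    measurable_fun D (EFin \o v).
  move=> mD D0; apply/measurable_EFinP.
  apply: (measurable_funS _ D0) => //.
  apply: open_continuous_measurable_fun => // t.
  by rewrite inE/= in_itv/= andbT => /cv.
have s0D : (`]0, s[%classic : set R) `<=` `]0, +oo[%classic.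
  by move=> t; rewrite /= !in_itv/= => /andP[->].
have syD : (`[s, +oo[%classic : set R) `<=` `]0, +oo[%classic.
  by move=> t; rewrite /= !in_itv/= !andbT; apply: lt_le_trans.
have I1 : (\int[mu]_(t in `]0%R, s[) (v t - u t)%:E = (F s)%:E)%E.
  rewrite (_ : F s = F s - F 0); last by rewrite F0 subr0.
  apply: ge0_oo_continuous_FTC2 => //.
  - move=> t /andP[t0 ts]; rewrite vuE// !mulr_ge0 ?expR_ge0 ?abspow_ge0 ?powR_ge0//.
    by rewrite subr_ge0 ltW.
  - by move=> t /andP[t0 _]; apply: continuousB; [exact: cv|exact: cu].
  - by move=> t /andP[t0 _]; exact: dF.
  - exact/cvg_at_right_filter/cu.
  - exact/cvg_at_left_filter/cu.
have I2 : (\int[mu]_(t in `[s, +oo[) (u t - v t)%:E = (F s)%:E)%E.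
  rewrite (_ : (F s)%:E = 0%R%:E - (- F s)%:E)%E; last by rewrite -EFinB sub0r opprK.
  apply: (@ge0_continuous_FTC2y _ _ (fun t => - F t)).
  - move=> t st; have t0 : 0 < t by exact: lt_le_trans st.
    rewrite -opprB vuE// -mulrN opprB !mulr_ge0 ?expR_ge0 ?abspow_ge0 ?powR_ge0//.
    by rewrite subr_ge0.
  - apply: continuous_in_subspaceT => t; rewrite inE => /syD/=.
    rewrite in_itv/= andbT => t0.
    by apply: continuousB; [exact: cu|exact: cv].
  - rewrite -[X in _ --> X]oppr0; apply: cvgN.
    exact: abspow_expRN_cvgy.
  - move=> t st; have /dF[] : 0 < t by exact: lt_trans st.
    by move=> /derivableN.
  - by apply: cvg_at_right_filter; apply: continuousN; exact: cu.
  - move=> t; rewrite in_itv/= andbT => st.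
    have /dF h : 0 < t by exact: lt_trans st.
    by rewrite derive1E (@derive_val _ _ _ _ _ _ _ (is_deriveN h)) opprB.
(* The larger function is integrated as a sum of two nonnegative ones, so no difference of possibly
   infinite integrals occurs. *)
have J1 : (\int[mu]_(t in `]0%R, s[) (v t)%:E =
    (F s)%:E + \int[mu]_(t in `]0%R, s[) (u t)%:E)%E.
  rewrite -I1 -ge0_integralD//=.
  - by apply: eq_integral => t _; rewrite -EFinD subrK.
  - move=> t; rewrite in_itv/= => /andP[t0 ts].
    by rewrite lee_fin vuE// !mulr_ge0 ?expR_ge0 ?abspow_ge0 ?powR_ge0// subr_ge0 ltW.
  - apply/measurable_EFinP; apply: measurable_funB.
      by apply/measurable_EFinP; exact: mv.
    by apply/measurable_EFinP; exact: mu_.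
  - by move=> t _; rewrite lee_fin.
  - exact: mu_.
have J2 : (\int[mu]_(t in `[s, +oo[) (u t)%:E =
    (F s)%:E + \int[mu]_(t in `[s, +oo[) (v t)%:E)%E.
  rewrite -I2 -ge0_integralD//=.
  - by apply: eq_integral => t _; rewrite -EFinD subrK.
  - move=> t; rewrite in_itv/= andbT => st.
    have t0 : 0 < t by exact: lt_le_trans st.
    rewrite lee_fin -opprB vuE// -mulrN opprB.
    by rewrite !mulr_ge0 ?expR_ge0 ?abspow_ge0 ?powR_ge0// subr_ge0.
  - apply/measurable_EFinP; apply: measurable_funB.
      by apply/measurable_EFinP; exact: mu_.
    by apply/measurable_EFinP; exact: mv.
  - by move=> t _; rewrite lee_fin.
  - exact: mv.
have K1 : (\int[mu]_(t in `]0%R, s[) (u t)%:E < +oo)%E.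
  apply: (@le_lt_trans _ _ (\int[mu]_(t in `]0%R, s[) (s `^ s)%:E)%E).
    apply: ge0_le_integral => //=.
    - by move=> t _; rewrite lee_fin.
    - exact: mu_.
    - move=> t; rewrite in_itv/= => /andP[t0 ts]; rewrite lee_fin /u /F /abspow gtr0_norm//.
      rewrite -[leRHS]mulr1 ler_pM ?abspow_ge0 ?powR_ge0 ?expR_ge0//.
        by apply: ge0_ler_powR; rewrite ?nnegrE ltW.
      by rewrite -expR0 ler_expR oppr_le0 ltW.
  by rewrite integral_cst//= lebesgue_measure_itv/= lte_fin s0 ltry.
(* As [s - 1 <= 0], the power [t^(s-1)] is largest at [t = s] on this half-line, which leaves a
   multiple of [e^(-t)] as majorant. *)
have K2 : (\int[mu]_(t in `[s, +oo[) (v t)%:E < +oo)%E.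
  pose C := s * s `^ (s - 1).
  have C0 : 0 <= C by rewrite mulr_ge0 ?abspow_ge0 ?powR_ge0// ltW.
  have cCE : continuous (fun t => C * E t).
    by move=> t; apply: (@continuousM _ _ (fun=> C) E); [exact: cst_continuous|exact: cE].
  have dE (t : R) : is_derive t 1 (fun t => - (C * E t)) (C * E t).
    have d2 : is_derive t 1 E (- E t).
      have := @is_derive1_comp R expR -%R t (expR (- t)) (-1) _ _.
      rewrite mulrN1; apply; exact: is_deriveNid.
    apply: (@is_derive_eq _ _ _ (- (C *: E))).
    by rewrite scalerN opprK.
  have CE : (\int[mu]_(t in `[s, +oo[) (C * E t)%:E = 0%R%:E - (- (C * E s))%:E)%E.
    apply: (@ge0_continuous_FTC2y _ _ (fun t => - (C * E t))).
    - by move=> t _; rewrite mulr_ge0 ?expR_ge0.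
    - exact: continuous_subspaceT.
    - rewrite -[X in _ --> X]oppr0; apply: cvgN.
      rewrite -[X in _ --> X](mulr0 C); apply: cvgM; first exact: cvg_cst.
      exact: cvgr_expR.
    - by move=> t _; case: (dE t).
    - by apply: cvg_at_right_filter; apply: cvgN; exact: cCE.
    - by move=> t _; rewrite derive1E; case: (dE t).
  apply: (@le_lt_trans _ _ (\int[mu]_(t in `[s, +oo[) (C * E t)%:E)%E); last first.
    by rewrite CE -EFinB ltry.
  apply: ge0_le_integral => //=.
  - by move=> t _; rewrite lee_fin.
  - exact: mv.
  - have : measurable_fun [set: R] (fun t => C * E t) by exact: continuous_measurable_fun.
    by move=> mCE; apply/measurable_EFinP/measurable_funTS.
  - move=> t; rewrite in_itv/= andbT => st; rewrite lee_fin ler_wpM2r ?expR_ge0//.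
    have t0 : 0 < t by exact: lt_le_trans st.
    rewrite /C ler_wpM2l ?(ltW s0)// /abspow gtr0_norm//.
    rewrite -(opprB 1 s) !powRN lef_pV2 ?posrE ?powR_gt0//.
    by apply: ge0_ler_powR; rewrite ?nnegrE ?subr_ge0 ?(ltW s0) ?(ltW t0).
have US : `]0, +oo[%classic = `]0, s[%classic `|` `[s, +oo[%classic :> set R.
  by rewrite -itv_bndbnd_setU ?bnd_simp// ltW.
have DS : [disjoint `]0%R, s[%classic & `[s, +oo[%classic].
  apply/disj_setPS => t [] /=; rewrite !in_itv/= andbT => /andP[_ ts] st.
  by rewrite ltNge st in ts.
have U1 : (\int[mu]_(t in `]0%R, +oo[) (u t)%:E =
    \int[mu]_(t in `]0%R, s[) (u t)%:E + \int[mu]_(t in `[s, +oo[) (u t)%:E)%E.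
  rewrite US ge0_integral_setU//=.
  - by apply: mu_; exact: measurableU.
  - by move=> t _; rewrite lee_fin.
have U2 : (\int[mu]_(t in `]0%R, +oo[) (v t)%:E =
    \int[mu]_(t in `]0%R, s[) (v t)%:E + \int[mu]_(t in `[s, +oo[) (v t)%:E)%E.
  rewrite US ge0_integral_setU//=.
  - by apply: mv; [exact: measurableU|rewrite subUset].
  - by move=> t _; rewrite lee_fin.
have k1 : (0 <= \int[mu]_(t in `]0%R, s[) (u t)%:E)%E.
  by apply: integral_ge0 => t _; rewrite lee_fin.
have k2 : (0 <= \int[mu]_(t in `[s, +oo[) (v t)%:E)%E.
  by apply: integral_ge0 => t _; rewrite lee_fin.
(* After this substitution both totals consist of [F s] and the same two finite pieces, [r1] and
   [r2], and can be compared as real numbers. *)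
move: U1 U2; rewrite J1 J2.
move: K1 k1; case: (integral _ _ _) => [r1| |]//= _; rewrite lee_fin => r10.
move: K2 k2; case: (integral _ _ _) => [r2| |]//= _; rewrite lee_fin => r20.
rewrite -!EFinD => U1 U2.
have Gs1 : Gamma (s + 1) = r1 + (F s + r2).
  rewrite /Gamma -[RHS]/(fine (r1 + (F s + r2))%:E) -U1; congr fine.
  apply: eq_integral => t; rewrite inE/= in_itv/= andbT => t0.
  by rewrite /u /F /abspow gtr0_norm// addrK.
have Gs : Gamma s = s^-1 * (F s + r1 + r2).
  rewrite /Gamma -[RHS]/(fine (s^-1%:E * (F s + r1 + r2)%:E)%E) -U2.
  rewrite -ge0_integralZl_EFin//; last 3 first.
  - by move=> t _; rewrite lee_fin.
  - exact: mv.
  - by rewrite invr_ge0 ltW.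
  congr fine; apply: eq_integral => t; rewrite inE/= in_itv/= andbT => t0.
  by rewrite -EFinM /v /abspow gtr0_norm// -!mulrA mulKf// gt_eqF.
rewrite Gs Gs1; split; last by rewrite mulVKf ?gt_eqF//; lra.
by rewrite mulr_gt0 ?invr_gt0//; lra.
Qed.

(** * The weight and the comparison function on half of the interval *)

(** With [w = u + v > 0], the ratio [z / w] lies in [[0, 1]] and so is at most [(z / w)^s].
    Multiplying by [w^s] and adding the cases [z = u] and [z = v] gives the claim, as the ratios sum
    to 1. *)
Lemma ler_powRD {R : realType} (s u v : R) : 0 < s <= 1 -> 0 <= u -> 0 <= v ->
  (u + v) `^ s <= u `^ s + v `^ s.
Proof.
move=> /andP[s0 s1] u0 v0; have [uv0|uv0] := eqVneq (u + v) 0.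
  by rewrite uv0 powR0 ?gt_eqF// addr_ge0 ?powR_ge0.
have w0 : 0 < u + v by rewrite lt_neqAle eq_sym uv0 addr_ge0.
have H z : 0 <= z -> z <= u + v -> (u + v) `^ s * (z / (u + v)) <= z `^ s.
  move=> z0 zw; have [->|zn0] := eqVneq z 0; first by rewrite mul0r mulr0 powR_ge0.
  have -> : z `^ s = (u + v) `^ s * (z / (u + v)) `^ s.
    by rewrite -powRM ?divr_ge0 ?(ltW w0)// mulrC divfK.
  rewrite ler_wpM2l ?powR_ge0// ger1_powR// divr_gt0//=; last first.
    by rewrite lt_neqAle eq_sym zn0.
  by rewrite ler_pdivrMr// mul1r.
have := lerD (H u u0 _) (H v v0 _); rewrite lerDl lerDr => /(_ v0 u0).
by rewrite -mulrDr -mulrDl divff// mulr1.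
Qed.

(** For [u >= v] this is subadditivity applied to [u = (u - v) + v]; the other case is symmetric. *)
Lemma ler_dist_powR {R : realType} (s u v : R) : 0 < s <= 1 -> 0 <= u -> 0 <= v ->
  `|u `^ s - v `^ s| <= `|u - v| `^ s.
Proof.
move=> s01; wlog uv : u v / v <= u => [hwlog|] u0 v0.
  have [vu|/ltW uv] := leP v u; first exact: hwlog.
  by rewrite distrC (distrC u); exact: hwlog.
have /andP[s0 s1] := s01.
rewrite [in leRHS]ger0_norm ?subr_ge0// ger0_norm; last first.
  by rewrite subr_ge0 ge0_ler_powR ?nnegrE// ltW.
by rewrite lerBlDr -[in leLHS](subrK v u) ler_powRD// subr_ge0.
Qed.

(* If x and y are functions and P, Q the integrals of x^p and y^q, integrating
   this inequality gives Hoelder's inequality. *)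
Lemma young_normalized {R : realType} (p q P Q x y : R) :
  0 < p -> 0 < q -> p^-1 + q^-1 = 1 -> 0 < P -> 0 < Q -> 0 <= x -> 0 <= y ->
  x * y <= P `^ p^-1 * Q `^ q^-1 * (x `^ p / (p * P) + y `^ q / (q * Q)).
Proof.
move=> p0 q0 pq P0 Q0 x0 y0.
have Pp : 0 < P `^ p^-1 by rewrite powR_gt0.
have Qq : 0 < Q `^ q^-1 by rewrite powR_gt0.
(* Each factor is divided by its intended norm before Young's inequality is applied. *)
have -> : x * y = P `^ p^-1 * Q `^ q^-1 * ((x / P `^ p^-1) * (y / Q `^ q^-1)).
  by field; rewrite !gt_eqF.
rewrite ler_pM2l ?mulr_gt0//.
have H r z Z : 0 < r -> 0 < Z -> 0 <= z -> z `^ r / (r * Z) = (z / Z `^ r^-1) `^ r / r.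
  move=> r0 Z0 z0; rewrite -powRN powRM ?powR_ge0//.
  by rewrite -powRrM mulNr mulVf ?gt_eqF// powR_inv1 ?(ltW Z0)// invfM; ring.
rewrite !H//; apply: conjugate_powR => //; by rewrite divr_ge0 ?powR_ge0.
Qed.

Lemma is_derive_abspow_affine {R : realType} (r k l t : R) : 0 < k * t + l ->
  is_derive t 1 (fun t => abspow r (k * t + l)) (k * (r * abspow (r - 1) (k * t + l))).
Proof.
move=> h; rewrite mulrC.
apply: (@is_derive1_comp R (abspow r) (fun t => k * t + l)).
  exact: gt0_is_derive_abspow.
apply: (@is_derive_eq _ _ _ (k *: id + cst l)).
by rewrite addr0 /GRing.scale/= mulr1.
Qed.

Lemma is_derive_abspow_subr {R : realType} (r a t : R) : a < t ->
  is_derive t 1 (fun t => abspow r (t - a)) (r * abspow (r - 1) (t - a)).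
Proof.
move=> ta; have h t' : t' - a = 1 * t' + - a by rewrite mul1r.
under eq_fun do rewrite h.
rewrite h -[r * _]mul1r; apply: is_derive_abspow_affine.
by rewrite -h subr_gt0.
Qed.

Lemma is_derive_abspow_subl {R : realType} (r b t : R) : t < b ->
  is_derive t 1 (fun t => abspow r (b - t)) (- (r * abspow (r - 1) (b - t))).
Proof.
move=> tb; have h t' : b - t' = -1 * t' + b by rewrite mulN1r addrC.
under eq_fun do rewrite h.
rewrite h -[- (_ * _)]mulN1r; apply: is_derive_abspow_affine.
by rewrite -h subr_gt0.
Qed.

(** Sum of the two Caputo kernels: [(b - t)^(s-1)] comes from the left derivative evaluated at [b],
    [(t - a)^(s-1)] from the right derivative evaluated at [a]. *)
Definition weight {R : realType} (s a b t : R) : R :=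
  abspow (s - 1) (t - a) + abspow (s - 1) (b - t).

(* Primitive of s times the weight, normalised to vanish at the midpoint. *)
Definition weight_prim {R : realType} (s a b t : R) : R :=
  abspow s (t - a) - abspow s (b - t).

Lemma weight_ge0 {R : realType} (s a b t : R) : 0 <= weight s a b t.
Proof. by rewrite addr_ge0 ?abspow_ge0. Qed.

Lemma is_derive_weight_prim {R : realType} (s a b t : R) : a < t < b ->
  is_derive t 1 (weight_prim s a b) (s * weight s a b t).
Proof.
move=> /andP[ta tb].
have da := is_derive_abspow_subr s a t ta; have db := is_derive_abspow_subl s b t tb.
apply: (@is_derive_eq _ _ _ ((fun t => abspow s (t - a)) - (fun t => abspow s (b - t)))).
by rewrite /weight; ring.
Qed.

Lemma continuous_weight {R : realType} (s a b t : R) : a < t < b ->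
  {for t, continuous (weight s a b)}.
Proof.
move=> /andP[ta tb]; apply: cvgD.
  apply: (@continuous_comp _ _ _ (fun t => t - a) (abspow (s - 1))).
    by apply: cvgB; [exact: cvg_id|exact: cvg_cst].
  by apply: gt0_continuous_abspow; rewrite subr_gt0.
apply: (@continuous_comp _ _ _ (fun t => b - t) (abspow (s - 1))).
  by apply: cvgB; [exact: cvg_cst|exact: cvg_id].
by apply: gt0_continuous_abspow; rewrite subr_gt0.
Qed.

Lemma continuous_weight_prim {R : realType} (s a b : R) : 0 < s ->
  continuous (weight_prim s a b).
Proof.
move=> s0 t; apply: cvgB.
  apply: (@continuous_comp _ _ _ (fun t => t - a) (abspow s)).
    by apply: cvgB; [exact: cvg_id|exact: cvg_cst].
  exact: continuous_abspow.
apply: (@continuous_comp _ _ _ (fun t => b - t) (abspow s)).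
  by apply: cvgB; [exact: cvg_cst|exact: cvg_id].
exact: continuous_abspow.
Qed.

(** With [u = t - a] and [v = b - t] the difference [u - v] is [-(a + b - 2t)], so [ler_dist_powR]
    applies. *)
Lemma ler_norm_weight_prim {R : realType} (s a b t : R) : 0 < s <= 1 ->
  a <= t <= b -> `|weight_prim s a b t| <= abspow s (a + b - 2 * t).
Proof.
move=> s01 /andP[ta tb].
have := @ler_dist_powR _ s (t - a) (b - t) s01.
rewrite !subr_ge0 => /(_ ta tb).
rewrite /weight_prim /abspow (@ger0_norm _ (t - a)) ?subr_ge0//.
rewrite (@ger0_norm _ (b - t)) ?subr_ge0// => /le_trans; apply.
rewrite le_eqVlt -normrN; apply/orP; left; apply/eqP.
by congr (`| _ | `^ _); ring.
Qed.

(* The two halves of [a, b] correspond to e = a, sg = 1 and e = b, sg = -1.  The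
   first term of Z is the boundary term of an integration by parts, the other two
   are primitives of the right-hand side of the last pointwise bound. *)
Lemma weighted_half_bound {R : realType} (a b s p C1 C2 A B sg x y e : R)
    (phi G Z : R -> R) :
  0 < s <= 1 -> 0 < p -> a <= x -> x < y -> y <= b -> sg * sg = 1 ->
  (forall t, x < t < y -> 0 < sg * (a + b - 2 * t)) ->
  continuous phi ->
  (forall t, a <= t <= b -> is_derive t 1 G (phi t)) ->
  (forall t, x < t < y -> 0 <= sg * (G t - G e)) ->
  (forall t, x < t < y -> 0 <= phi t) ->
  (forall t, x < t < y -> abspow s (a + b - 2 * t) * phi t <=
    C1 * abspow (s * p) (a + b - 2 * t) + C2 * ((b - t) * A + (t - a) * B)) ->
  Z = (fun t => sg * (weight_prim s a b t * (G t - G e))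
    - sg * (C1 / (2 * (s * p + 1))) * abspow (s * p + 1) (a + b - 2 * t)
    + C2 / 2 * (B * (t - a) ^+ 2 - A * (b - t) ^+ 2)) ->
  (\int[mu]_(t in `]x, y[)
    (s * weight s a b t * (sg * (G t - G e)))%:E
   <= (Z y - Z x)%:E)%E.
Proof.
move=> s01 p0 ax xy yb sg2 sgt cphi dG Ge phi0 young ZE.
have /andP[s0 s1] := s01.
have absg : `|sg| = 1.
  have /eqP := congr1 Num.norm sg2.
  rewrite normrM normr1 -expr2 sqrf_eq1 => /orP[/eqP//|/eqP sgN].
  by have := normr_ge0 sg; rewrite sgN; lra.
have abssg r u : abspow r (sg * u) = abspow r u by rewrite /abspow normrM absg mul1r.
have sp0 : 0 < s * p by rewrite mulr_gt0.
pose W := weight_prim s a b; pose om := weight s a b.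
(* [Z'] is the derivative of [Z]: the integrand, plus [sg W phi] from differentiating [G], plus the
   right-hand side of the Young bound. *)
pose Z' t := sg * (s * om t * (G t - G e) + W t * phi t)
  + C1 * abspow (s * p) (a + b - 2 * t) + C2 * ((b - t) * A + (t - a) * B).
(* [abspow] is even and [sg] is 1 or -1, so the argument may be multiplied by [sg]; it is then
   positive and the power rule applies. *)
have dc r t : x < t < y -> is_derive t 1 (fun t => abspow r (a + b - 2 * t))
    (- 2 * sg * (r * abspow (r - 1) (a + b - 2 * t))).
  move=> /sgt xty.
  have h t' : sg * (a + b - 2 * t') = (- 2 * sg) * t' + sg * (a + b) by ring.
  have h1 r1 t' : abspow r1 (a + b - 2 * t') = abspow r1 ((- 2 * sg) * t' + sg * (a + b)).
    by rewrite -h abssg.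
  under eq_fun do rewrite h1.
  by rewrite h1; apply: is_derive_abspow_affine; rewrite -h.
have xyoo (t : R) : x < t < y -> a < t < b.
  by move=> /andP[h1 h2]; rewrite (le_lt_trans ax h1) (lt_le_trans h2 yb).
have xyab (t : R) : x < t < y -> a <= t <= b.
  by move=> /andP[h1 h2]; rewrite (le_trans ax (ltW h1)) (le_trans (ltW h2) yb).
have dZ (t : R) : x < t < y -> is_derive t 1 Z (Z' t).
  move=> xty.
  rewrite ZE; have dc1 := dc (s * p + 1) t xty.
  have dG1 := dG t (xyab t xty).
  have dW : is_derive t 1 W (s * om t) := is_derive_weight_prim s a b t (xyoo t xty).
  pose qa (t : R) := t - a; pose qb (t : R) := b - t.
  have dqa : is_derive t 1 qa 1.
    by apply: (@is_derive_eq _ _ _ (id - cst a)); rewrite subr0.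
  have dqb : is_derive t 1 qb (-1).
    by apply: (@is_derive_eq _ _ _ (cst b - id)); rewrite sub0r.
  have d1 : is_derive t 1 (fun t => sg * (W t * (G t - G e)))
      (sg * (s * om t * (G t - G e) + W t * phi t)).
    have dGe : is_derive t 1 (fun t => G t - G e) (phi t).
      by apply: (@is_derive_eq _ _ _ (G - cst (G e))); rewrite subr0.
    apply: (@is_derive_eq _ _ _ (sg *: (W * (fun t => G t - G e)))).
    by rewrite /GRing.scale/=; ring.
  have d2 : is_derive t 1
      (fun t => sg * (C1 / (2 * (s * p + 1))) * abspow (s * p + 1) (a + b - 2 * t))
      (- (C1 * abspow (s * p) (a + b - 2 * t))).
    apply: (@is_derive_eq _ _ _ ((sg * (C1 / (2 * (s * p + 1)))) *:
      (fun t => abspow (s * p + 1) (a + b - 2 * t)))).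
    rewrite /GRing.scale/= addrK.
    transitivity (- ((sg * sg) * C1 * abspow (s * p) (a + b - 2 * t))).
      by field; rewrite gt_eqF// addr_gt0.
    by rewrite sg2 mul1r.
  have d3 : is_derive t 1 (fun t => C2 / 2 * (B * (t - a) ^+ 2 - A * (b - t) ^+ 2))
      (C2 * ((b - t) * A + (t - a) * B)).
    apply: (@is_derive_eq _ _ _ ((C2 / 2) *: (B *: (qa ^+ 2) - A *: (qb ^+ 2)))).
    by rewrite /GRing.scale/= /qa /qb; field.
  set z1 := (fun t => _) in d1; set z2 := (fun t => _) in d2.
  set z3 := (fun t => _) in d3.
  apply: (@is_derive_eq _ _ _ (z1 - z2 + z3)).
  by rewrite opprK.
have cG (t : R) : a <= t <= b -> {for t, continuous G}.
  by move=> /dG[+ _] => dGt; exact/differentiable_continuous/derivable1_diffP.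
have ca : continuous (fun t : R => t - a).
  by move=> t; apply: cvgB; [exact: cvg_id|exact: cvg_cst].
have cb : continuous (fun t : R => b - t).
  by move=> t; apply: cvgB; [exact: cvg_cst|exact: cvg_id].
have cc : continuous (fun t : R => a + b - 2 * t).
  move=> t; apply: cvgB; first exact: cvg_cst.
  by apply: cvgM; [exact: cvg_cst|exact: cvg_id].
have cpow r (u : R -> R) (t : R) : 0 < r -> continuous u ->
    {for t, continuous (fun t : R => abspow r (u t))}.
  move=> r0 cu; apply: (@continuous_comp _ _ _ u (abspow r)); first exact: cu.
  exact: continuous_abspow.
have cWG (t : R) : a <= t <= b -> {for t, continuous (fun t : R => W t * (G t - G e))}.
  move=> tab; apply: cvgM.
    exact: continuous_weight_prim.
  by apply: cvgB; [exact: cG|exact: cvg_cst].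
have cZ (t : R) : a <= t <= b -> {for t, continuous Z}.
  move=> tab; rewrite ZE; apply: cvgD.
    apply: cvgB.
      by apply: cvgM; [exact: cvg_cst|exact: cWG].
    apply: cvgM; first exact: cvg_cst.
    by apply: (cpow _ _ t _ cc); rewrite addr_gt0.
  apply: cvgM; first exact: cvg_cst.
  apply: cvgB; apply: cvgM; (try exact: cvg_cst); rewrite !expr2; apply: cvgM.
  - exact: ca.
  - exact: ca.
  - exact: cb.
  - exact: cb.
have com (t : R) : x < t < y -> {for t, continuous om}.
  by move=> /xyoo; exact: continuous_weight.
have csom (t : R) : x < t < y -> {for t, continuous (fun t : R => s * om t)}.
  by move=> /com com_t; apply: cvgM => //; exact: cvg_cst.
have cGe (t : R) : x < t < y -> {for t, continuous (fun t : R => G t - G e)}.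
  by move=> /xyab /cG cGt; apply: cvgB => //; exact: cvg_cst.
have cZ' t : x < t < y -> {for t, continuous Z'}.
  move=> txy; apply: cvgD.
    apply: cvgD.
      apply: cvgM; first exact: cvg_cst.
      apply: cvgD.
        by apply: cvgM; [exact: csom|exact: cGe].
      apply: cvgM; last exact: cphi.
      exact: continuous_weight_prim.
    apply: cvgM; first exact: cvg_cst.
    exact: (cpow _ _ t sp0 cc).
  apply: cvgM; first exact: cvg_cst.
  by apply: cvgD; apply: cvgM; (try exact: cvg_cst); [exact: cb|exact: ca].
have lo (t : R) : x < t < y -> 0 <= s * om t * (sg * (G t - G e)).
  by move=> txy; apply: mulr_ge0; [apply: mulr_ge0; [exact: ltW|exact: weight_ge0]|exact: Ge].
(* The difference of the two sides is [sg W phi] plus the Young bound. It is nonnegative because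
   [-sg W phi <= |W| phi], which that bound dominates. *)
have hi (t : R) : x < t < y -> s * om t * (sg * (G t - G e)) <= Z' t.
  move=> txy; have hW := ler_norm_weight_prim s a b t s01 (xyab t txy).
  have : - (sg * W t) * phi t <= abspow s (a + b - 2 * t) * phi t.
    apply: ler_wpM2r; first exact: phi0.
    by apply: le_trans hW; rewrite -[leRHS]mul1r -absg -normrM -normrN ler_norm.
  move=> /le_trans /(_ (young t txy)); rewrite /Z'; lra.
(* [Z'] dominates a nonnegative integrand, hence is nonnegative, and its integral is the increment
   of [Z] even if it is singular at an endpoint. *)
rewrite -(@ge0_oo_continuous_FTC2 _ Z')//.
- apply: ge0_le_integral => //=.
  + apply/measurable_EFinP; apply: open_continuous_measurable_fun => // t.
    rewrite inE/= in_itv/= => txy; apply: cvgM; first exact: csom.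
    by apply: cvgM; [exact: cvg_cst|exact: cGe].
  + apply/measurable_EFinP; apply: open_continuous_measurable_fun => // t.
    by rewrite inE/= in_itv/=; exact: cZ'.
- by move=> t txy; rewrite (le_trans (lo t txy))// hi.
- by apply/cvg_at_right_filter/cZ; rewrite ax (le_trans (ltW xy)).
- by apply/cvg_at_left_filter/cZ; rewrite yb (le_trans ax (ltW xy)).
Qed.

(** * Comparing increments of a function with those of a primitive of a bound for its derivative *)

Lemma continuous_primitive {R : realType} (f : R -> R) (a b : R) :
  continuous f ->
  exists F : R -> R, forall t, a <= t <= b -> is_derive t 1 F (f t).
Proof.
(* Integrating from [a - 1], and working up to [b + 1], makes the derivative two-sided at both [a]
   and [b]. *)
move=> cf; exists (fun y => \int[mu]_(t in `[a - 1, y]) f t)%R => t /andP[ta tb].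
have tb1 : t < b + 1 by lra.
have [] := @continuous_FTC1_closed R f (a - 1) t (b + 1) tb1 _ _ (cf t).
- apply: continuous_compact_integrable; first exact: segment_compact.
  exact: continuous_subspaceT.
- lra.
- by move=> dF FE; split; [exact: dF|rewrite -derive1E; exact: FE].
Qed.

(** [G - g] and [G + g] have nonnegative derivatives; by the mean value theorem both have
    nonnegative increments, which together bound [|g y - g x|]. *)
Lemma dist_le_of_derive_le {R : realType} (g h G phi : R -> R) (x y : R) :
  x <= y ->
  {within `[x, y], continuous g} -> {within `[x, y], continuous G} ->
  (forall t, x < t < y -> is_derive t 1 g (h t)) ->
  (forall t, x < t < y -> is_derive t 1 G (phi t)) ->
  (forall t, x < t < y -> `|h t| <= phi t) ->
  `|g y - g x| <= G y - G x.
Proof.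
rewrite le_eqVlt => /predU1P[->|xy] cg cG dg dG hphi.
  by rewrite !subrr normr0.
have H (f : R -> R) (df : R -> R) : {within `[x, y], continuous f} ->
    (forall t, x < t < y -> is_derive t 1 f (df t)) ->
    (forall t, x < t < y -> 0 <= df t) -> 0 <= f y - f x.
  move=> cf d0 df0.
  have d1 (t : R) : t \in `]x, y[ -> is_derive t 1 f (df t).
    by rewrite in_itv/=; exact: d0.
  have [c cxy ->] := MVT xy d1 cf.
  by rewrite mulr_ge0 ?subr_ge0 ?(ltW xy)// df0//; move: cxy; rewrite in_itv.
have h1 := H (G - g) (phi - h).
have h2 := H (G + g) (phi + h).
have {}h1 : 0 <= (G y - g y) - (G x - g x).
  apply: h1.
  - by move=> t; apply: cvgB; [exact: cG|exact: cg].
  - by move=> t txy; have := dg t txy; have := dG t txy => d1 d2; exact: is_deriveB.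
  - by move=> t /hphi; rewrite ler_norml subr_ge0 => /andP[].
have {}h2 : 0 <= (G y + g y) - (G x + g x).
  apply: h2.
  - by move=> t; apply: cvgD; [exact: cG|exact: cg].
  - by move=> t txy; have := dg t txy; have := dG t txy => d1 d2; exact: is_deriveD.
  - by move=> t /hphi; rewrite ler_norml -subr_ge0 opprK addrC => /andP[].
by rewrite ler_norml; apply/andP; split; lra.
Qed.

(** * Integrability and integrals against the weight *)

Section weighted_integrals.
Context {R : realType} (s a b : R).
Hypotheses (s01 : 0 < s <= 1) (ab : a < b).
Let c := (a + b) / 2.
Let w := weight s a b.

Let s0 : 0 < s. Proof. by case/andP: s01. Qed.

Lemma weight_integral (x y : R) : a <= x -> x < y -> y <= b ->
  (\int[mu]_(t in `]x, y[) (s * w t)%:E =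
   (weight_prim s a b y - weight_prim s a b x)%:E)%E.
Proof.
move=> ax xy yb.
have oo (t : R) : x < t < y -> a < t < b.
  by move=> /andP[h1 h2]; rewrite (le_lt_trans ax h1) (lt_le_trans h2 yb).
apply: ge0_oo_continuous_FTC2 => //.
- by move=> t _; rewrite mulr_ge0 ?weight_ge0// ltW.
- by move=> t /oo h; apply: cvgM; [exact: cvg_cst|exact: continuous_weight].
- by move=> t /oo h; exact: is_derive_weight_prim.
- exact/cvg_at_right_filter/continuous_weight_prim.
- exact/cvg_at_left_filter/continuous_weight_prim.
Qed.

Lemma measurable_weight : measurable_fun `]a, b[ w.
Proof.
apply: open_continuous_measurable_fun => // t; rewrite inE/= in_itv/=.
exact: continuous_weight.
Qed.

(** The fundamental theorem gives [s * w] a finite integral, so its multiple [M * w] is an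
    integrable majorant. *)
Lemma weight_dominated_integrable (M : R) (k : R -> R) :
  measurable_fun `]a, b[ k ->
  (forall t, a < t < b -> `|k t| <= M * w t) ->
  mu.-integrable `]a, b[ (EFin \o k).
Proof.
move=> mk kM.
have iw : mu.-integrable `]a, b[ (EFin \o (fun t => s * w t)).
  apply/integrableP; split.
    by apply/measurable_EFinP; apply: measurable_funM => //; exact: measurable_weight.
  under eq_integral => t _.
    rewrite /= ger0_norm ?mulr_ge0 ?weight_ge0 ?(ltW s0)//. over.
  by rewrite weight_integral// ltry.
have iM : mu.-integrable `]a, b[ (EFin \o (fun t => M * w t)).
  have : mu.-integrable `]a, b[ (fun t => (M / s)%:E * (EFin \o (fun t => s * w t)%R) t)%E.
    exact: integrableZl.
  apply: eq_integrable => // t _ /=; rewrite -EFinM; congr EFin; field.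
  exact: lt0r_neq0.
apply: le_integrable iM => //; first exact/measurable_EFinP.
move=> t /=; rewrite in_itv/= => /kM h; rewrite lee_fin.
by rewrite (le_trans h)// ler_norm.
Qed.

Lemma Rintegral_split_mid (k : R -> R) : mu.-integrable `]a, b[ (EFin \o k) ->
  (\int[mu]_(t in `]a, b[) k t = \int[mu]_(t in `]a, c[) k t
    + \int[mu]_(t in `]c, b[) k t)%R.
Proof.
move=> ik; have [ac cb] : a < c /\ c < b by case: (midf_lt ab).
rewrite -(@Rintegral_itvB _ _ (BRight a) (BLeft b) c)//; last first.
  exact: ltW.
rewrite (@Rintegral_itv_bndo_bndc _ (BRight a) c); last first.
  by apply: integrableS ik => //; apply: subset_itvl; exact: ltW.
by rewrite addrC subrK.
Qed.

End weighted_integrals.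

(** The increment of [weight_prim] is the integral of [s * weight], so the quantity inside the norm
    is the integral of [s * weight * (g e - g)], and [|g e - g|] is bounded pointwise by the
    increment of [G]. *)
Lemma weighted_half_error {R : realType} (s a b x y e sg D M : R) (g G : R -> R) :
  0 < s <= 1 -> a < b -> a <= x -> x < y -> y <= b ->
  measurable_fun `]a, b[ g -> (forall t, a < t < b -> `|g t| <= M) ->
  measurable_fun `]x, y[ G ->
  (forall t, x < t < y -> `|g e - g t| <= sg * (G t - G e)) ->
  (\int[mu]_(t in `]x, y[) (s * weight s a b t * (sg * (G t - G e)))%:E <= D%:E)%E ->
  `|(weight_prim s a b y - weight_prim s a b x) * g e
    - s * (\int[mu]_(t in `]x, y[) (g t * weight s a b t))%R| <= D.
Proof.
move=> s01 ab ax xy yb mg gM mG gG hD; have /andP[s0 s1] := s01.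
have sub : (`]x, y[%classic : set R) `<=` `]a, b[%classic.
  by apply: subset_itv; rewrite bnd_simp.
have iS (k : R -> R) : mu.-integrable `]a, b[ (EFin \o k) ->
    mu.-integrable `]x, y[ (EFin \o k).
  by move=> ik; apply: integrableS ik.
have mw := measurable_weight s a b.
have igw : mu.-integrable `]x, y[ (EFin \o (fun t => g t * weight s a b t)).
  apply: iS.
  apply: (weight_dominated_integrable _ _ _ s01 ab M).
    exact: measurable_funM.
  move=> t /gM tM; rewrite normrM (ger0_norm (weight_ge0 _ _ _ _)).
  by rewrite ler_wpM2r ?weight_ge0.
have isw : mu.-integrable `]x, y[ (EFin \o (fun t => s * weight s a b t)).
  apply: iS.
  apply: (weight_dominated_integrable _ _ _ s01 ab s).
    exact: measurable_funM.
  by move=> t _; rewrite normrM (ger0_norm (weight_ge0 _ _ _ _)) gtr0_norm.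
have iswg : mu.-integrable `]x, y[ (EFin \o (fun t => s * (g t * weight s a b t))).
  by apply: eq_integrable (integrableZl _ s igw) => // t _ /=.
have iswe : mu.-integrable `]x, y[ (EFin \o (fun t => s * weight s a b t * g e)).
  by apply: eq_integrable (integrableZr _ (g e) isw) => // t _ /=.
have -> : weight_prim s a b y - weight_prim s a b x =
    (\int[mu]_(t in `]x, y[) (s * weight s a b t))%R.
  by rewrite /Rintegral weight_integral.
rewrite -RintegralZr// -RintegralZl// -RintegralB//.
have ik : mu.-integrable `]x, y[ (EFin \o (fun t =>
    s * weight s a b t * g e - s * (g t * weight s a b t))).
  by apply: eq_integrable (integrableB _ iswe iswg) => // t _ /=.
have mk := measurable_int mu ik; have msw := measurable_int mu isw.
rewrite -lee_fin EFin_normr_Rintegral//.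
apply: (le_trans _ hD).
apply: (le_trans (le_abse_integral _ _ _)) => //.
apply: ge0_le_integral => //=.
- by apply/measurable_EFinP; apply: measurableT_comp => //; apply/measurable_EFinP; exact: mk.
- apply/measurable_EFinP; apply: measurable_funM.
    by apply/measurable_EFinP; exact: msw.
  by apply: measurable_funM => //; exact: measurable_funB.
move=> t; rewrite in_itv/= => txy; rewrite lee_fin.
rewrite [X in `|X|](_ : _ = s * weight s a b t * (g e - g t)); last by ring.
have sw0 : 0 <= s * weight s a b t by rewrite mulr_ge0 ?weight_ge0// ltW.
by rewrite normrM ger0_norm// ler_wpM2l// gG.
Qed.

(** Endpoints have measure zero, and inside the interval dividing by a power [1 - s] is multiplying
    by the power [s - 1], so the kernels add up to [weight]. *)
Lemma endpoint_kernels_integral {R : realType} (s a b M : R) (g : R -> R) :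
  0 < s <= 1 -> a < b ->
  measurable_fun `]a, b[ g -> (forall t, a < t < b -> `|g t| <= M) ->
  (\int[mu]_(t in `[a, b]) (g t / (b - t) `^ (1 - s))
   + \int[mu]_(t in `[a, b]) (g t / (t - a) `^ (1 - s))
   = \int[mu]_(t in `]a, b[) (g t * weight s a b t))%R.
Proof.
move=> s01 ab mg gM; have /andP[s0 s1] := s01.
have m1 : measurable_fun `]a, b[ (fun t => g t / (b - t) `^ (1 - s)).
  rewrite (_ : (fun t => _) = (fun t => g t * (b - t) `^ (- (1 - s)))); last first.
    by apply/funext => t; rewrite powRN.
  apply: measurable_funM => //.
  apply: (measurableT_comp (measurable_powR _)) => //.
  exact: measurable_funB.
have m2 : measurable_fun `]a, b[ (fun t => g t / (t - a) `^ (1 - s)).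
  rewrite (_ : (fun t => _) = (fun t => g t * (t - a) `^ (- (1 - s)))); last first.
    by apply/funext => t; rewrite powRN.
  apply: measurable_funM => //.
  apply: (measurableT_comp (measurable_powR _)) => //.
  exact: measurable_funB.
have E1 t : a < t < b -> (b - t) `^ (1 - s) = (abspow (s - 1) (b - t))^-1.
  move=> /andP[_ tb]; rewrite /abspow gtr0_norm ?subr_gt0//.
  by rewrite -(opprB 1 s) powRN invrK.
have E2 t : a < t < b -> (t - a) `^ (1 - s) = (abspow (s - 1) (t - a))^-1.
  move=> /andP[ta _]; rewrite /abspow gtr0_norm ?subr_gt0//.
  by rewrite -(opprB 1 s) powRN invrK.
have i1 : mu.-integrable `]a, b[ (EFin \o (fun t => g t / (b - t) `^ (1 - s))).
  apply: (weight_dominated_integrable _ _ _ s01 ab M) => // t tab.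
  rewrite E1// invrK normrM (ger0_norm (abspow_ge0 _ _)) ler_pM ?abspow_ge0 ?gM//.
  by rewrite /weight lerDr abspow_ge0.
have i2 : mu.-integrable `]a, b[ (EFin \o (fun t => g t / (t - a) `^ (1 - s))).
  apply: (weight_dominated_integrable _ _ _ s01 ab M) => // t tab.
  rewrite E2// invrK normrM (ger0_norm (abspow_ge0 _ _)) ler_pM ?abspow_ge0 ?gM//.
  by rewrite /weight lerDl abspow_ge0.
have oc (k : R -> R) : measurable_fun `]a, b[ k ->
    (\int[mu]_(t in `[a, b]) k t = \int[mu]_(t in `]a, b[) k t)%R.
  by move=> mk; rewrite /Rintegral integral_itv_bndoo//; exact/measurable_EFinP.
rewrite !oc// -RintegralD//.
apply: eq_Rintegral => t; rewrite inE/= in_itv/= => tab.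
by rewrite E1// E2// !invrK -mulrDr addrC.
Qed.

(** The first two factors form the Hoelder bound [K] of [weighted_trapezoid]. The powers of [L]
    collapse by [1/p + 1/q = 1]: [L^(s + 1/p) L^(1/q) / L^s = L]. *)
Lemma bound_constant {R : realType} (s p q L A B : R) :
  0 < s -> 0 < L -> 1 < q -> p = q / (q - 1) -> 0 <= A -> 0 <= B ->
  (L `^ (s * p + 1) / (s * p + 1)) `^ p^-1 * (L * (A + B) / 2) `^ q^-1
    / (2 * L `^ s)
  = L / 2 `^ (1 + 1 / q) * (1 / (p * s + 1) `^ (1 / p)) * (A + B) `^ (1 / q).
Proof.
move=> s0 L0 q1 pE A0 B0.
have q0 : 0 < q by lra.
have p0 : 0 < p by rewrite pE divr_gt0// subr_gt0.
have pq : p^-1 + q^-1 = 1.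
  by rewrite pE; field; rewrite (lt0r_neq0 q0) subr_eq0 gt_eqF.
have sp0 : 0 < s * p + 1 by rewrite addr_gt0// mulr_gt0.
rewrite !div1r (mulrC p s).
rewrite powRM ?powR_ge0 ?invr_ge0 ?(ltW sp0)//.
have AB0 : 0 <= A + B by rewrite addr_ge0.
have -> : (L * (A + B) / 2) `^ q^-1 = L `^ q^-1 * (A + B) `^ q^-1 * 2^-1 `^ q^-1.
  by rewrite !powRM ?invr_ge0 ?mulr_ge0 ?(ltW L0).
rewrite [2 `^ (1 + _)]powRD ?pnatr_eq0 ?implybT// powRr1//.
have inv r z : 0 < z -> z^-1 `^ r = (z `^ r)^-1 :> R.
  by move=> z0; rewrite -(powR_inv1 (ltW z0)) -powRrM mulN1r powRN.
rewrite !inv// -powRrM.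
have -> : L `^ ((s * p + 1) * p^-1) = L `^ s * L `^ p^-1.
  rewrite -powRD; last by rewrite (gt_eqF L0) implybT.
  by congr (_ `^ _); field; exact: lt0r_neq0.
have LE : L = L `^ p^-1 * L `^ q^-1.
  rewrite -powRD; last by rewrite (gt_eqF L0) implybT.
  by rewrite pq powRr1// ltW.
rewrite [in RHS]LE.
have h1 : L `^ s != 0 by rewrite powR_eq0 gt_eqF.
have h2 : (2 : R) `^ q^-1 != 0 by rewrite powR_eq0 pnatr_eq0.
have h3 : (s * p + 1) `^ p^-1 != 0 by rewrite powR_eq0 gt_eqF.
by field; rewrite h1 h2 h3.
Qed.

(** * The estimate for functions with a bounded derivative *)

(** The analytic core, free of [Gamma] and of [m]: convexity enters only through the affine bound on
    [|h|^q]. *)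
Lemma weighted_trapezoid {R : realType} (s p q a b A B : R) (g h : R -> R) :
  0 < s <= 1 -> 1 < q -> p = q / (q - 1) -> a < b -> 0 <= A -> 0 <= B ->
  {within `[a, b], continuous g} ->
  (forall t, a < t < b -> is_derive t 1 g (h t)) ->
  (forall t, a < t < b -> `|h t| `^ q <= ((b - t) * A + (t - a) * B) / (b - a)) ->
  `|(g a + g b) / 2 - s / (2 * (b - a) `^ s)
     * (\int[mu]_(t in `[a, b]) (g t / (b - t) `^ (1 - s))
        + \int[mu]_(t in `[a, b]) (g t / (t - a) `^ (1 - s)))%R|
  <= (b - a) / 2 `^ (1 + 1 / q) * (1 / (p * s + 1) `^ (1 / p))
     * (A + B) `^ (1 / q).
Proof.
move=> s01 q1 pE ab A0 B0 cg dg hA; have /andP[s0 s1] := s01.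
have q0 : 0 < q by lra.
have p0 : 0 < p by rewrite pE divr_gt0// subr_gt0.
have pq : p^-1 + q^-1 = 1.
  by rewrite pE; field; rewrite (lt0r_neq0 q0) subr_eq0 gt_eqF.
have sp0 : 0 < s * p + 1 by rewrite addr_gt0// mulr_gt0.
pose L := b - a; pose c := (a + b) / 2.
have L0 : 0 < L by rewrite subr_gt0.
have [ac cb] : a < c /\ c < b by case: (midf_lt ab).
pose l t := ((b - t) * A + (t - a) * B) / L.
have l0 t : a < t < b -> 0 <= l t.
  move=> /andP[at_ tb]; rewrite divr_ge0 ?(ltW L0)//.
  by rewrite addr_ge0 ?mulr_ge0 ?subr_ge0 ?(ltW at_) ?(ltW tb).
pose phi t := abspow q^-1 (l t).
have cphi : continuous phi.
  have cl : continuous l.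
    move=> t; apply: cvgM; last exact: cvg_cst.
    apply: cvgD; apply: cvgM; (try exact: cvg_cst).
      by apply: cvgB; [exact: cvg_cst|exact: cvg_id].
    by apply: cvgB; [exact: cvg_id|exact: cvg_cst].
  move=> t; apply: (@continuous_comp _ _ _ l (abspow q^-1)); first exact: cl.
  by apply: continuous_abspow; rewrite invr_gt0.
have phi0 t : 0 <= phi t by exact: abspow_ge0.
have phiE t : a < t < b -> phi t `^ q = l t.
  move=> tab; rewrite /phi /abspow -powRrM mulVf ?gt_eqF// powRr1// ger0_norm//.
  exact: l0.
have hphi t : a < t < b -> `|h t| <= phi t.
  move=> tab; rewrite -[leLHS]powRr1// -(mulfV (lt0r_neq0 q0)) powRrM.
  rewrite /phi /abspow ge0_ler_powR ?nnegrE ?powR_ge0 ?invr_ge0 ?(ltW q0)//.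
  by rewrite (le_trans (hA t tab))// ler_norm.
have [G dG] := continuous_primitive phi a b cphi.
have cG t : a <= t <= b -> {for t, continuous G}.
  by move=> /dG[+ _] => dGt; exact/differentiable_continuous/derivable1_diffP.
have gG x y : a <= x -> x <= y -> y <= b -> `|g y - g x| <= G y - G x.
  move=> ax xy yb.
  have sub t : x < t < y -> a < t < b.
    by move=> /andP[h1 h2]; rewrite (le_lt_trans ax h1) (lt_le_trans h2 yb).
  apply: (@dist_le_of_derive_le _ g h G phi) => //.
  - by apply: continuous_subspaceW cg; apply: subset_itv; rewrite bnd_simp.
  - apply: continuous_in_subspaceT => t; rewrite inE/= in_itv/= => /andP[xt ty].
    by apply: cG; rewrite (le_trans ax xt) (le_trans ty yb).
  - by move=> t /sub; exact: dg.
  - by move=> t /sub/andP[h1 h2]; apply: dG; rewrite !ltW.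
  - by move=> t /sub; exact: hphi.
have mg : measurable_fun `]a, b[ g.
  apply: open_continuous_measurable_fun => // t; rewrite inE/= in_itv/= => /dg[+ _] => dgt.
  exact/differentiable_continuous/derivable1_diffP.
have mG x y : a <= x -> y <= b -> measurable_fun `]x, y[ G.
  move=> ax yb; apply: open_continuous_measurable_fun => // t.
  rewrite inE/= in_itv/= => /andP[xt ty].
  by apply: cG; rewrite (le_trans ax (ltW xt)) (le_trans (ltW ty) yb).
(* A uniform bound on [g] makes its product with the weight integrable; the increments of [G]
   provide one. *)
have gM t : a < t < b -> `|g t| <= `|g a| + (G b - G a).
  move=> /andP[h1 h2].
  rewrite -[g t](subrK (g a)) addrC (le_trans (ler_normD _ _))// lerD2l.
  have g1 := gG a t (lexx a) (ltW h1) (ltW h2).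
  have g2 := gG t b (ltW h1) (ltW h2) (lexx b).
  by rewrite (le_trans g1)// lerD2r -subr_ge0 (le_trans _ g2).
rewrite (endpoint_kernels_integral _ _ _ _ _ s01 ab mg gM).
rewrite -(bound_constant _ _ _ _ _ _ s0 L0 q1 pE A0 B0).
(* [P] and [Q] are the integrals over [[a, b]] of [|a + b - 2t|^(s p)] and of [phi^q = l]; [K] is
   the resulting Hoelder bound. *)
pose P := L `^ (s * p + 1) / (s * p + 1).
pose Q := L * (A + B) / 2.
pose K := P `^ p^-1 * Q `^ q^-1.
have P0 : 0 < P by rewrite divr_gt0// powR_gt0.
have Q0 : 0 <= Q by apply: divr_ge0 => //; apply: mulr_ge0; [exact: ltW|exact: addr_ge0].
(* These are the coefficients in [young_normalized]; the extra division by [L] is the denominator of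
   [l]. *)
pose C1 := K / (p * P); pose C2 := K / (q * Q) / L.
have young t : a < t < b -> abspow s (a + b - 2 * t) * phi t <=
    C1 * abspow (s * p) (a + b - 2 * t) + C2 * ((b - t) * A + (t - a) * B).
  (* [young_normalized] needs [Q > 0]. If [Q = 0], then [A = B = 0] and [phi] vanishes on the
     interval, while [K], [C1] and [C2] are zero. *)
  move=> tab; have [Q00|Qn0] := eqVneq Q 0.
    have K0 : K = 0 by rewrite /K Q00 powR0 ?mulr0// invr_neq0// lt0r_neq0.
    rewrite /C1 /C2 K0 !mul0r addr0.
    move/eqP: Q00; rewrite /Q !mulf_eq0 gt_eqF//= invr_eq0 pnatr_eq0 orbF.
    rewrite paddr_eq0// => /andP[/eqP A00 /eqP B00].
    by rewrite /phi /l A00 B00 !mulr0 addr0 mul0r abspow0 ?mulr0// invr_gt0.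
  have Qp : 0 < Q by rewrite lt_neqAle eq_sym Qn0.
  apply: le_trans (young_normalized p q P Q _ _ p0 q0 pq P0 Qp (abspow_ge0 _ _) (phi0 t)) _.
  rewrite phiE// {1}/abspow -powRrM -/(abspow _ _) -/K /C1 /C2 /l.
  by rewrite le_eqVlt; apply/orP; left; apply/eqP; field; rewrite !gt_eqF.
pose Z e sg t := sg * (weight_prim s a b t * (G t - G e))
    - sg * (C1 / (2 * (s * p + 1))) * abspow (s * p + 1) (a + b - 2 * t)
    + C2 / 2 * (B * (t - a) ^+ 2 - A * (b - t) ^+ 2).
have half x y e sg : a <= x -> x < y -> y <= b -> sg * sg = 1 ->
    (forall t, x < t < y -> 0 < sg * (a + b - 2 * t)) ->
    (forall t, x < t < y -> `|g e - g t| <= sg * (G t - G e)) ->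
    `|(weight_prim s a b y - weight_prim s a b x) * g e
    - s * (\int[mu]_(t in `]x, y[) (g t * weight s a b t))%R| <= Z e sg y - Z e sg x.
  move=> ax xy yb sg2 sgt gGe.
  have sub t : x < t < y -> a < t < b.
    by move=> /andP[h1 h2]; rewrite (le_lt_trans ax h1) (lt_le_trans h2 yb).
  apply: (weighted_half_error _ _ _ _ _ _ sg _ _ _ _ s01 ab ax xy yb mg gM (mG x y ax yb)) => //.
  apply: (weighted_half_bound _ _ s p C1 C2 A B sg x y e phi G _ s01 p0 ax xy yb sg2 sgt cphi dG) => //.
  - by move=> t txy; rewrite (le_trans _ (gGe t txy)).
  - by move=> t /sub; exact: young.
have cc : a + b - 2 * c = 0 by rewrite /c; field.
(* On the left half [G t >= G a], on the right half [G t <= G b]; the signs 1 and -1 match this as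
   well as the sign of [a + b - 2t]. *)
have left_ := half a c a 1 (lexx a) ac (ltW cb) (mulr1 1).
have right_ := half c b b (-1) (ltW ac) cb (lexx b).
rewrite mulrNN mulr1 in right_.
have {left_}Hl : `|(weight_prim s a b c - weight_prim s a b a) * g a
    - s * (\int[mu]_(t in `]a, c[) (g t * weight s a b t))%R| <= Z a 1 c - Z a 1 a.
  apply: left_ => t /andP[h1 h2]; rewrite mul1r; first by rewrite /c in h2; lra.
  by rewrite distrC gG ?(ltW h1)// ltW// (lt_trans h2).
have {right_}Hr : `|(weight_prim s a b b - weight_prim s a b c) * g b
    - s * (\int[mu]_(t in `]c, b[) (g t * weight s a b t))%R| <= Z b (-1) b - Z b (-1) c.
  apply: right_ => // t /andP[h1 h2]; rewrite mulN1r; first by rewrite /c in h1; lra.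
  by rewrite opprB gG ?(ltW h2)// ltW// (lt_trans ac).
(* The values of [weight_prim] at [a], [c] and [b] turn the two half errors into errors for
   [L^s * g a] and [L^s * g b]. *)
have wa : weight_prim s a b a = - L `^ s.
  by rewrite /weight_prim subrr abspow0// sub0r /abspow gtr0_norm.
have wb : weight_prim s a b b = L `^ s.
  by rewrite /weight_prim subrr abspow0// subr0 /abspow gtr0_norm.
have wc : weight_prim s a b c = 0.
  rewrite /weight_prim (_ : c - a = b - c) ?subrr// /c; by field.
have igw : mu.-integrable `]a, b[ (EFin \o (fun t => g t * weight s a b t)).
  apply: (weight_dominated_integrable _ _ _ s01 ab (`|g a| + (G b - G a))).
    by apply: measurable_funM => //; exact: measurable_weight.
  move=> t /gM tM; rewrite normrM (ger0_norm (weight_ge0 _ _ _ _)).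
  by rewrite ler_wpM2r ?weight_ge0.
rewrite (Rintegral_split_mid a b ab _ igw) -/c -/L.
move: Hl Hr; rewrite wa wb wc sub0r opprK subr0.
set Il := (\int[mu]_(t in `]a, c[) _)%R; set Ir := (\int[mu]_(t in `]c, b[) _)%R.
move=> Hl Hr.
have Ls : 0 < L `^ s by rewrite powR_gt0.
have -> : (g a + g b) / 2 - s / (2 * L `^ s) * (Il + Ir) =
    ((L `^ s * g a - s * Il) + (L `^ s * g b - s * Ir)) / (2 * L `^ s).
  by field; rewrite gt_eqF.
rewrite normrM [`|_^-1|]ger0_norm ?invr_ge0 ?mulr_ge0 ?(ltW Ls)//.
rewrite ler_pM2r ?invr_gt0 ?mulr_gt0//.
apply: (le_trans (ler_normD _ _)); apply: (le_trans (lerD Hl Hr)).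
have za : abspow (s * p + 1) (a + b - 2 * a) = L `^ (s * p + 1).
  by rewrite /abspow (_ : a + b - 2 * a = L) ?gtr0_norm// /L; ring.
have zb : abspow (s * p + 1) (a + b - 2 * b) = L `^ (s * p + 1).
  by rewrite /abspow (_ : a + b - 2 * b = - L) ?normrN ?gtr0_norm// /L; ring.
(* The boundary terms vanish: at [c] because [weight_prim] does, at [a] and [b] because [e] is that
   endpoint. The other terms of the two halves add up to [C1 * P + C2 * (L * Q)]. *)
rewrite /Z za zb cc abspow0// wc !subrr -/P -/Q -/K.
(* The weights [1/p] and [1/q] sum to 1, so the integrated Young bound gives back exactly [K]. *)
have KE : C1 * P + C2 * (L * Q) = K.
  have [Q00|Qn0] := eqVneq Q 0.
    have K0 : K = 0 by rewrite /K Q00 powR0 ?mulr0// invr_neq0// lt0r_neq0.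
    by rewrite /C1 /C2 K0; ring.
  have general (k u v z : R) : u != 0 -> v != 0 -> z != 0 ->
      k / (p * u) * u + k / (q * v) / z * (z * v) = k * (p^-1 + q^-1).
    by move=> u0 v0 z0; field; rewrite u0 v0 z0 !gt_eqF.
  by rewrite /C1 /C2 general ?pq ?mulr1// gt_eqF.
rewrite -[leRHS]KE le_eqVlt; apply/orP; left; apply/eqP.
move: (lt0r_neq0 sp0); rewrite /P /Q -[b - a]/L.
move: (G c - G a) (G c - G b) (weight_prim s a b a) (weight_prim s a b b).
move: (c - a) (b - c) (L `^ (s * p + 1)) (s * p + 1) (C1) (C2) (L).
by move=> u v X D k1 k2 z g1 g2 w1 w2 D0; field.
Qed.

(** * One-sided derivatives *)

Lemma derive_on_dist {R : realType} (I : set R) (g : R -> R) (x e : R) :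
  cvg (diff_quotient_on I g x) -> 0 < e ->
  exists2 d, 0 < d & forall y, I y -> y != x -> `|x - y| < d ->
    `|derive_on I g x - (g y - g x) / (y - x)| < e.
Proof.
move=> cvg_q e0.
have nb : nbhs (derive_on I g x) (ball (derive_on I g x) e) by exact: nbhsx_ballx.
have /nbhs_ballP[d /= d0 dq] := cvg_q _ nb.
by exists d => // y Iy yx xy; exact: dq.
Qed.

Lemma derivable_on_within_continuous {R : realType} (I D : set R) (g : R -> R) :
  derivable_on I g -> D `<=` I -> {within D, continuous g}.
Proof.
move=> dg DI; apply/subspace_continuousP => x Dx; apply/cvgrPdist_lt => e e0.
have [d d0 dq] := derive_on_dist _ _ _ _ (dg x (DI x Dx)) (@ltr01 R).
set l := derive_on I g x in dq; have l0 : 0 < `|l| + 1 by rewrite ltr_wpDl.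
(* Within the first radius slopes differ from [l] by less than 1, so
   [|g y - g x| <= (|l| + 1) |x - y|]; the second radius makes this less than [e]. *)
apply/nbhs_ballP; exists (Num.min d (e / (`|l| + 1))) => /=.
  by rewrite lt_min d0 divr_gt0.
move=> y; rewrite /ball/= lt_min => /andP[yd ye] Dy.
have [->|yx] := eqVneq y x; first by rewrite subrr normr0.
have := dq y (DI y Dy) yx yd; rewrite distrC => lq.
have yx0 : y - x != 0 by rewrite subr_eq0.
rewrite distrC -[g y - g x](divfK yx0) normrM [`|y - x|]distrC.
move: ye; rewrite ltr_pdivlMr// => ye; apply: le_lt_trans ye; rewrite mulrC.
apply: ler_wpM2l => //.
rewrite -[X in `|X|](subrK l) addrC (le_trans (ler_normD _ _))// lerD2l ltW//.
Qed.

(** Points close enough to [t] lie in [[a, b]], hence in [I], so there the quotient restricted to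
    [I] is the ordinary two-sided one. *)
Lemma is_derive_derive_on {R : realType} (I : set R) (g : R -> R) (a b t : R) :
  derivable_on I g -> `[a, b] `<=` I -> a < t < b ->
  is_derive t 1 g (derive_on I g t).
Proof.
move=> dg abI /andP[at_ tb].
have It : I t by apply: abI; rewrite /= in_itv/= !ltW.
suff H : (fun h => h^-1 *: (g (h *: 1 + t) - g t)) @ 0^' --> derive_on I g t.
  by apply: DeriveDef; [apply/cvg_ex; exists (derive_on I g t)|exact/cvg_lim].
apply/cvgrPdist_lt => e e0.
have [d d0 dq] := derive_on_dist _ _ _ _ (dg t It) e0.
apply/nbhs_ballP; exists (Num.min d (Num.min (t - a) (b - t))) => /=.
  by rewrite !lt_min d0 !subr_gt0 at_.
move=> k; rewrite /ball/= sub0r normrN !lt_min => /and3P[kd ka kb] k0.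
have tE : t + k - t = k by rewrite addrC addKr.
have := dq (t + k); rewrite tE opprD addNKr normrN.
have -> : k *: 1 + t = t + k by rewrite /GRing.scale/= mulr1 addrC.
rewrite /GRing.scale/= mulrC; apply => //.
- apply: abI; rewrite /= in_itv/=; move: ka kb; rewrite !ltr_norml => /andP[? ?] /andP[? ?].
  by apply/andP; split; lra.
- by rewrite -subr_eq0 tE.
Qed.

(** * Reduction of the Caputo inequality to the weighted trapezoid estimate *)

Theorem theorem4 (R : realType) (alpha : R) (n : nat) (m p q a b : R)
    (I : set R) (f : R -> R)
    (alpha_gt0 : 0 < alpha)
    (alpha_notin : forall k : nat, (0 < k)%N -> alpha <> k%:R)
    (nE : n = caputo_order alpha)
    (m_bounds : 0 < m <= 1)
    (q_gt1 : 1 < q)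
    (pE : p = q / (q - 1))
    (a_lt_b : a < b)
    (I_itv : is_interval I)
    (ab_I : `[a, b] `<=` I)
    (abm_I : forall y, a <= y <= b -> I (y / m))
    (f_der : n_times_derivable_on I n.+1 f)
    (f_int : (@lebesgue_measure R).-integrable `[a, b]
               (EFin \o derive_n_on I n.+1 f))
    (f_cvx : m_convex_on m a b (fun x => `|derive_n_on I n.+1 f x| `^ q)) :
  `| (derive_n_on I n f a + derive_n_on I n f b) / 2
     - Gamma (n%:R - alpha + 1) / (2 * (b - a) `^ (n%:R - alpha))
       * (caputo_left I alpha a f b + (-1) ^+ n * caputo_right I alpha b f a) |
  <= (b - a) / 2 `^ (1 + 1 / q)
     * (1 / (p * (n%:R - alpha) + 1) `^ (1 / p))
     * (`|derive_n_on I n.+1 f a| `^ q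
        + m * `|derive_n_on I n.+1 f (b / m)| `^ q) `^ (1 / q).
Proof.
pose s := n%:R - alpha; pose g := derive_n_on I n f.
(* [n] is the integer part of [alpha] plus one, so [n - 1 <= alpha < n]. *)
have s01 : 0 < s <= 1.
  have /andP[h1 h2] := Num.Theory.truncn_itv (ltW alpha_gt0).
  rewrite /s nE /caputo_order subr_gt0 h2/= lerBlDl -natr1.
  by rewrite lerD2r.
have /andP[m0 m1] := m_bounds.
have [Gs0 Gs1] := Gamma_recursion s s01.
have dg : derivable_on I g := f_der n (ltnSn n).
(* The sign in the right derivative cancels against the factor in front, and both derivatives share
   the factor [1 / Gamma s]. *)
have -> : caputo_left I alpha a f b + (-1) ^+ n * caputo_right I alpha b f a =
    (\int[mu]_(t in `[a, b]) (g t / (b - t) `^ (1 - s))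
     + \int[mu]_(t in `[a, b]) (g t / (t - a) `^ (1 - s)))%R / Gamma s.
  have sE : alpha - n%:R + 1 = 1 - s by rewrite /s; ring.
  rewrite /caputo_left /caputo_right -nE -/s -/g sE.
  by rewrite div1r mulrA mulrA -expr2 sqrr_sign div1r -mulrDr mulrC.
rewrite -/s -/g Gs1.
set J := (X in X / Gamma s).
have -> : s * Gamma s / (2 * (b - a) `^ s) * (J / Gamma s) =
    s / (2 * (b - a) `^ s) * J.
  by field; rewrite (gt_eqF Gs0) powR_eq0 subr_eq0 (gt_eqF a_lt_b).
have A0 : 0 <= `|derive_n_on I n.+1 f a| `^ q by exact: powR_ge0.
(* [derive_n_on I n.+1 f] unfolds to [derive_on I g], which plays the role of [h]; [A] is [|h(a)|^q]
   and [B] is [m |h(b/m)|^q]. *)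
apply: (weighted_trapezoid s p q a b _ _ g (derive_on I g) s01 q_gt1 pE a_lt_b A0).
- by rewrite mulr_ge0 ?powR_ge0// ltW.
- exact: (derivable_on_within_continuous _ _ _ dg ab_I).
- by move=> t; exact: is_derive_derive_on.
- move=> t /andP[at_ tb].
  have ab0 : b - a != 0 by rewrite subr_eq0 gt_eqF.
  have L0 : 0 < b - a by rewrite subr_gt0.
  (* [t] is the convex combination of [a] and [b] in which [a] has this coefficient; m-convexity at
     [x = a], [y = b] is then the required affine bound. *)
  have th0 : 0 <= (b - t) / (b - a) <= 1.
    rewrite divr_ge0 ?subr_ge0 ?(ltW tb) ?(ltW a_lt_b)//=.
    by rewrite ler_pdivrMr// mul1r lerD2l lerN2 ltW.
  have tE : (b - t) / (b - a) * a + (1 - (b - t) / (b - a)) * b = t by field.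
  have thE (u v : R) : (b - t) / (b - a) * u + m * (1 - (b - t) / (b - a)) * v =
      ((b - t) * u + (t - a) * (m * v)) / (b - a) by field.
  have aab : a <= a <= b by rewrite lexx ltW.
  have bab : a <= b <= b by rewrite lexx ltW.
  by have := f_cvx a b _ aab bab th0; rewrite tE thE.
Qed.
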